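(* Let $c,k$ be integers with $c\ge0$ and $k\ge1$. The Hilbert series of the generic determinantal variety $M_{k+1}(k+1+c,k+1)$ is of the form $q_{k,c}(t)/(1-t)^{k(k+2+c)}$, where $$q_{k,c}(t)=\sum_{j=0}^{k}\binom{c+j}{j}t^j=1+\binom{c+1}{1}t+\binom{c+2}{2}t^2+\dots+\binom{c+k}{k}t^k .$$
   Context: We work over $\mathbb{C}$. $M_s(m,n)\subset\mathbb{P}^{mn-1}$ denotes the generic determinantal variety, defined by the ideal generated by the $s\times s$ minors of an $m\times n$ matrix of independent indeterminates. Its Hilbert series is that of its homogeneous coordinate ring, i.e. of the polynomial ring in the $mn$ indeterminates modulo that ideal. *)

(* Defs.v *)
From HB Require Import structures.
From mathcomp Require Import all_boot all_order all_algebra.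
From mathcomp Require Export mpoly.
From mathcomp Require Import boolp.
From mathcomp Require Export reals complex.

Set Implicit Arguments.
Unset Strict Implicit.
Unset Printing Implicit Defensive.

Import GRing.Theory.
Local Open Scope ring_scope.

(* The classes of e_0, ..., e_(h-1) form a basis of the image of the subspace
   A in the quotient V/I; subspaces are given by their membership predicates. *)
Definition basis_mod (K : fieldType) (V : lmodType K) (A I : V -> Prop)
    (h : nat) (e : 'I_h -> V) : Prop :=
  [/\ forall i, A (e i),
      forall a : 'I_h -> K, I (\sum_(i < h) a i *: e i) -> forall i, a i = 0
    & forall v, A v ->
        exists a : 'I_h -> K, I (v - \sum_(i < h) a i *: e i)].

Definition ideal_gen (S : comNzRingType) (G : S -> Prop) (p : S) : Prop :=
  exists2 s : seq (S * S),
    (forall x, x \in s -> G x.2) & p = \sum_(x <- s) x.1 * x.2.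

(* The degree d component of K[X_0, ..., X_(n-1)]/(G) has dimension h. *)
Definition quotient_dim (K : fieldType) (n : nat) (G : {mpoly K[n]} -> Prop)
    (d h : nat) : Prop :=
  exists e : 'I_h -> {mpoly K[n]},
    basis_mod (fun p => p \is d.-homog) (ideal_gen G) e.

Section BasisMod.
Variables (K : fieldType) (V : lmodType K) (I : V -> Prop).
Hypotheses (I0 : I 0) (IP : forall a u v, I u -> I v -> I (a *: u + v)).

Lemma basis_mod_exists (s : seq V) :
  exists h (e : 'I_h -> V), (forall i, e i \in s) /\
    [/\ forall a : 'I_h -> K, I (\sum_(i < h) a i *: e i) -> forall i, a i = 0
    & forall v, v \in s -> exists a : 'I_h -> K, I (v - \sum_(i < h) a i *: e i)].
Proof.
elim: s => [|x s [h [e [es [efree espan]]]]].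
  by exists 0%N, (fun=> 0); split=> [[]//|]; split=> [a _ []//|].
case: (pselect (exists a : 'I_h -> K, I (x - \sum_(i < h) a i *: e i))) => [xe|xNe].
  exists h, e; split=> [i|]; first by rewrite inE es orbT.
  split=> // v; rewrite inE => /orP[/eqP ->|]; [exact: xe | exact: espan].
pose e' (i : 'I_h.+1) := oapp e x (unlift ord0 i).
have sum_e' (a : 'I_h.+1 -> K) :
    \sum_i a i *: e' i = a ord0 *: x + \sum_i a (lift ord0 i) *: e i.
  rewrite big_ord_recl /e' unlift_none; congr (_ + _).
  by apply: eq_bigr => i _; rewrite liftK.
exists h.+1, e'; split=> [i|].
  by rewrite /e'; case: unliftP => [j|] _ /=; rewrite inE ?es ?eqxx ?orbT.
split=> [a|v].
  rewrite sum_e' => Ia.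
  have a0 : a ord0 = 0.
    apply/eqP/negPn/negP => a_neq0; apply: xNe.
    exists (fun i => - (a ord0)^-1 * a (lift ord0 i)).
    have := IP (a ord0)^-1 Ia I0.
    rewrite addr0 scalerDr scalerA mulVf // scale1r scaler_sumr.
    congr (I (_ + _)); rewrite -sumrN; apply: eq_bigr => i _.
    by rewrite scalerA mulNr scaleNr opprK.
  move: Ia; rewrite a0 scale0r add0r => /efree ae i.
  by case: (unliftP ord0 i) => [j|] ->; rewrite ?ae.
rewrite inE => /orP[/eqP ->|/espan [a Ia]].
  exists (fun i => (i == ord0)%:R); rewrite sum_e' eqxx scale1r big1.
    by rewrite addr0 subrr.
  by move=> i _; rewrite /= scale0r.
exists (fun i => oapp a 0 (unlift ord0 i)).
rewrite sum_e' unlift_none scale0r add0r.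
by under eq_bigr do rewrite liftK.
Qed.

Lemma basis_mod_leq (A : V -> Prop) h h' (e : 'I_h -> V) (e' : 'I_h' -> V) :
  basis_mod A I e -> basis_mod A I e' -> (h' <= h)%N.
Proof.
move=> [_ _ espan] [e'A e'free _].
have [M MP] : exists M : 'M[K]_(h', h),
    forall j, I (e' j - \sum_i M j i *: e i).
  have /choice[f fP] := fun j => espan _ (e'A j).
  exists (\matrix_(j, i) f j i) => j.
  by under eq_bigr do rewrite mxE.
suff /eqP <- : row_free M by exact: rank_leq_col.
apply: inj_row_free => v vM0.
suff: forall j, v 0 j = 0 by move=> v0; apply/rowP => j; rewrite v0 mxE.
apply: e'free.
have: I (\sum_j v 0 j *: (e' j - \sum_i M j i *: e i)).
  apply: (big_ind I) => // [u w Iu Iw|j _]; first by rewrite -[u]scale1r; apply: IP.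
  by rewrite -[_ *: _]addr0; apply: IP.
congr I; under eq_bigr do rewrite scalerBr; rewrite sumrB [X in _ - X](_ : _ = 0) ?subr0 //.
under eq_bigr do rewrite scaler_sumr.
rewrite exchange_big big1 // => i _.
under eq_bigr do rewrite scalerA.
by rewrite -scaler_suml; have := congr1 (fun w : 'rV_h => w 0 i) vM0; rewrite !mxE => ->; rewrite scale0r.
Qed.

End BasisMod.

Section HilbertFunction.
Variables (K : fieldType) (n : nat) (G : {mpoly K[n]} -> Prop).

Lemma ideal_gen0 : ideal_gen G 0.
Proof. by exists [::]; rewrite ?big_nil. Qed.

Lemma ideal_genP (a : K) (p q : {mpoly K[n]}) :
  ideal_gen G p -> ideal_gen G q -> ideal_gen G (a *: p + q).
Proof.
move=> [s sG ->] [r rG ->].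
exists ([seq (a *: x.1, x.2) | x <- s] ++ r) => [x|].
  by rewrite mem_cat => /orP[/mapP[y ys ->]|]; [exact: (sG y) | exact: rG].
rewrite big_cat big_map scaler_sumr; congr (_ + _).
by apply: eq_bigr => x _; rewrite scalerAl.
Qed.

Lemma quotient_dim_exists (d : nat) : exists h, quotient_dim G d h.
Proof.
pose s := [seq 'X_[K, bmnm m] | m : 'X_{1..n < d.+1} <- enum {: 'X_{1..n < d.+1}} & mdeg (bmnm m) == d].
have [h [e [es [efree espan]]]] := basis_mod_exists ideal_gen0 ideal_genP s.
exists h, e; split=> // [i|p pd].
  by have /mapP[m + ->] := es i; rewrite mem_filter dhomogX => /andP[].
have : exists a : {mpoly K[n]} -> 'I_h -> K, forall m : 'X_{1..n}, m \in msupp p ->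
    ideal_gen G ('X_[m] - \sum_i a 'X_[m] i *: e i).
  have /choice[a aP] : forall v : {mpoly K[n]}, exists a : 'I_h -> K,
      v \in s -> ideal_gen G (v - \sum_i a i *: e i).
    move=> v; case: (boolP (v \in s)) => [/espan[a aP]|_]; first by exists a.
    by exists (fun=> 0).
  exists a => m mp; apply: aP.
  have md : mdeg m = d by apply: (dhomog_mf pd).
  have mlt : (mdeg m < d.+1)%N by rewrite md.
  by apply/mapP; exists (BMultinom mlt); rewrite // mem_filter mem_enum andbT; apply/eqP.
move=> [a aP]; exists (fun i => \sum_(m <- msupp p) p@_m * a 'X_[m] i).
suff: ideal_gen G (\sum_(m <- msupp p) p@_m *: ('X_[m] - \sum_i a 'X_[m] i *: e i)).
  congr ideal_gen; under eq_bigr do rewrite scalerBr; rewrite sumrB -mpolyE.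
  congr (_ - _); under [RHS]eq_bigr do rewrite scaler_suml.
  rewrite [RHS]exchange_big; apply: eq_bigr => m _.
  by rewrite scaler_sumr; apply: eq_bigr => i _; rewrite scalerA.
rewrite big_seq; apply: (big_ind (ideal_gen G)) => [|u w Iu Iw|m mp].
- exact: ideal_gen0.
- by rewrite -[u]scale1r; apply: ideal_genP.
- by rewrite -[_ *: _]addr0; apply: ideal_genP; [exact: aP | exact: ideal_gen0].
Qed.

Definition hilbert_function (d : nat) : nat :=
  projT1 (cid (quotient_dim_exists d)).

Lemma hilbert_functionP (d h : nat) :
  hilbert_function d = h <-> quotient_dim G d h.
Proof.
rewrite /hilbert_function; case: cid => h' [e' e'P] /=.
split=> [<-|[e eP]]; first by exists e'.
by apply/eqP; rewrite eqn_leq; apply/andP; split;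
  [exact: (basis_mod_leq ideal_gen0 ideal_genP eP e'P) | exact: (basis_mod_leq ideal_gen0 ideal_genP e'P eP)].
Qed.

End HilbertFunction.

(* Formal power series over the integers are represented by their coefficient
   sequences. *)
Definition hilbert_series (K : fieldType) (n : nat) (G : {mpoly K[n]} -> Prop)
  : nat -> int := fun d => (hilbert_function G d)%:Z.

(* f = p / q in Z[[t]], for q invertible there; the condition is f * q = p. *)
Definition is_series_of (f : nat -> int) (p q : {poly int}) : Prop :=
  q`_0 \is a GRing.unit /\
  forall d, \sum_(i < d.+1) f i * q`_(d - i) = p`_d.

Definition generic_matrix (K : fieldType) (m n : nat)
  : 'M[{mpoly K[m * n]}]_(m, n) := \matrix_(i, j) 'X_(mxvec_index i j).

Definition is_minor (S : comNzRingType) (m n s : nat) (A : 'M[S]_(m, n))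
    (p : S) : Prop :=
  exists (f : 'I_s -> 'I_m) (g : 'I_s -> 'I_n),
    [/\ {homo f : i j / (i < j)%N}, {homo g : i j / (i < j)%N}
      & p = \det (mxsub f g A)].

Definition determinantal_hilbert_series (K : fieldType) (s m n : nat)
  : nat -> int := hilbert_series (is_minor s (generic_matrix K m n)).

Definition q_poly (k c : nat) : {poly int} :=
  \sum_(j < k.+1) ('C(c + j, j)%:Z)%:P * 'X^j.

(* Main.v *)
Require Import Defs.
From mathcomp Require Import all_boot all_order all_fingroup all_algebra.
From mathcomp Require Import ring zify.

Set Implicit Arguments.
Unset Strict Implicit.
Unset Printing Implicit Defensive.

Import Order.TTheory GRing.Theory Num.Theory.
Local Open Scope ring_scope.

(* Call a monomial standard if it is divisible by no product
   x_(r_0,0) ... x_(r_(n-1),n-1) with r_0 < ... < r_(n-1). Such a product is the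
   leading term of a maximal minor, so the standard monomials span the quotient
   ring. They are linearly independent in it because a nonzero polynomial f
   vanishing on all matrices of rank < n contains a nonstandard monomial: letting
   the last entry x of the matrix go to infinity along matrices of rank < n shows
   that the top part of f in x vanishes as soon as the matrix without its last row
   and column is rank deficient, and one concludes by induction on the size.
   The same induction on the corner entry gives the generating function P(i,j) of
   the standard monomials for i x j matrices, up to the factor 1/(1-t)^(mn), as
   P(i+1,j+1) = (1-t) P(i,j+1) + t P(i,j), which Pascal's rule solves. *)

(** * Evaluation of polynomials along curves, and top slices in one variable *)

Section Evaluation.
Variables (K : numFieldType) (N : nat).
Implicit Types (f : {mpoly K[N]}) (u : 'X_{1..N}) (x : 'I_N).

(** Otherwise the roots 1, 2, ..., [size Q], distinct in characteristic 0, would be too many. *)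
Lemma poly_vanish0 (Q : {poly K}) : (forall s, s != 0 -> Q.[s] = 0) -> Q.[0] = 0.
Proof.
move=> Qs; suff -> : Q = 0 by rewrite horner0.
apply/eqP/negPn/negP => Q0.
pose rs := [seq i.+1%:R : K | i <- iota 0 (size Q)].
have /(max_poly_roots Q0) : all (root Q) rs.
  by apply/allP => _ /mapP[i _ ->]; rewrite rootE Qs // pnatr_eq0.
rewrite map_inj_uniq ?iota_uniq => [/(_ isT)|i j /eqP].
  by rewrite size_map size_iota ltnn.
by rewrite eqr_nat => /eqP[].
Qed.

Lemma mevalE_poly f (w : 'I_N -> {poly K}) s :
  (\sum_(u <- msupp f) f@_u *: \prod_l w l ^+ u l).[s] = f.@[fun l => (w l).[s]].
Proof.
rewrite mevalE horner_sum; apply: eq_bigr => u _.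
by rewrite hornerZ horner_prod; congr (_ * _); apply: eq_bigr => l _; rewrite horner_exp.
Qed.

(** An algebraic substitute for continuity: along the curve [w] the value of [f] is a polynomial in
    the parameter. *)
Lemma meval_vanish0 f (w : 'I_N -> {poly K}) :
    (forall s, s != 0 -> f.@[fun l => (w l).[s]] = 0) ->
  f.@[fun l => (w l).[0]] = 0.
Proof.
by move=> fs; rewrite -mevalE_poly; apply: poly_vanish0 => s /fs; rewrite -mevalE_poly.
Qed.

(** The factor x^d is kept, so every monomial of the slice is a monomial of [f]. *)
Definition slice x d f : {mpoly K[N]} :=
  \sum_(u <- msupp f | u x == d) f@_u *: 'X_[u].

Lemma mcoeff_slice x d f u : (slice x d f)@_u = if u x == d then f@_u else 0.
Proof.
rewrite /slice raddf_sum /=.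
under eq_bigr do rewrite mcoeffZ mcoeffX.
case: (boolP (u \in msupp f)) => fu; last first.
  rewrite (memN_msupp_eq0 fu) if_same big_seq_cond big1 // => w /andP[fw _].
  by case: eqP fu => [<-|_ _]; rewrite ?fw ?mulr0.
rewrite big_mkcond (bigD1_seq u) ?msupp_uniq //= eqxx mulr1 big1 ?addr0 //.
by move=> w /negPf ->; rewrite mulr0 if_same.
Qed.

Lemma msupp_slice x d f u : (u \in msupp (slice x d f)) = (u \in msupp f) && (u x == d).
Proof. by rewrite !mcoeff_msupp mcoeff_slice; case: (u x == d); rewrite ?andbT ?andbF ?eqxx. Qed.

Lemma mdeg_at_max x f : f != 0 ->
  exists2 d, (forall u, u \in msupp f -> (u x <= d)%N) & slice x d f != 0.
Proof.
move=> f0; pose P d := has (fun u : 'X_{1..N} => u x == d) (msupp f).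
have exP : exists d, P d.
  case E: (msupp f) => [|u s]; first by move: f0; rewrite -msupp_eq0 E.
  by exists (u x); apply/hasP; exists u; rewrite // E mem_head.
have ubP d : P d -> (d <= msize f)%N.
  case/hasP => u fu /eqP <-; apply: leq_trans (ltnW (msize_mdeg_lt fu)).
  by rewrite mdegE (bigD1 x) //= leq_addr.
case: (ex_maxnP exP ubP) => d /hasP[u fu ud] dmax; exists d.
  by move=> w fw; apply: dmax; apply/hasP; exists w.
by apply/eqP => g0; have := msupp_slice x d f u; rewrite g0 msupp0 fu ud.
Qed.

(* The value a / s of the coordinate x goes to infinity as s goes to 0, so
   only the terms of top degree in x survive after rescaling by s^d. *)
Lemma slice_vanish x d f a (w : 'I_N -> {poly K}) : a != 0 ->
    (forall u, u \in msupp f -> (u x <= d)%N) ->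
    (forall s, s != 0 -> f.@[fun l => if l == x then a / s else (w l).[s]] = 0) ->
  (slice x d f).@[fun l => (w l).[0]] = 0.
Proof.
move=> a0 xd fs.
pose Q : {poly K} := \sum_(u <- msupp f)
  (f@_u * a ^+ u x) *: ('X^(d - u x) * \prod_(l | l != x) w l ^+ u l).
have Q0 : Q.[0] = 0.
  apply: poly_vanish0 => s s0; rewrite -(mulr0 (s ^+ d)) -(fs _ s0) mevalE mulr_sumr horner_sum.
  rewrite !big_seq; apply: eq_bigr => u /xd ud.
  rewrite hornerZ hornerM hornerXn horner_prod [in RHS](bigD1 x) //= eqxx.
  have -> : \prod_(l | l != x) (w l ^+ u l).[s]
    = \prod_(l | l != x) (if l == x then a / s else (w l).[s]) ^+ u l.
    by apply: eq_bigr => l /negPf ->; rewrite horner_exp.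
  rewrite -{2}(subnK ud) exprD expr_div_n.
  have : s ^+ u x != 0 by rewrite expf_neq0.
  move: (s ^+ u x) (\prod_(_ | _) _) => z pr z0.
  by field.
(* The slice carries the factor [(w x).[0] ^+ d] where [Q] carries [a ^+ d], hence the
   cross-multiplied form. *)
suff E : a ^+ d * (slice x d f).@[fun l => (w l).[0]] = (w x).[0] ^+ d * Q.[0].
  by apply/eqP; move/eqP: E; rewrite Q0 mulr0 mulf_eq0 expf_eq0 (negPf a0) andbF.
rewrite /slice raddf_sum /= horner_sum !mulr_sumr [LHS]big_mkcond !big_seq.
apply: eq_bigr => u /xd ud.
rewrite hornerZ hornerM hornerXn horner_prod.
case: eqP => [<-|uxd]; last first.
  have : (0 < d - u x)%N by lia.
  by move=> du; rewrite expr0n eqn0Ngt du /= mul0r !mulr0.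
rewrite subnn expr0 mul1r mevalZ mevalX (bigD1 x) //=.
under [in RHS]eq_bigr do rewrite horner_exp.
by ring.
Qed.

(** Slicing in one variable after another preserves both vanishing everywhere and being nonzero. It
    ends with a single monomial, which is nonzero at the all-ones point. *)
Lemma meval_eq0 f : (forall v, f.@[v] = 0) -> f = 0.
Proof.
move=> f0; apply/eqP/negPn/negP => fN0.
have [g [gN0 g0 gc]] : exists g : {mpoly K[N]}, [/\ g != 0, forall v, g.@[v] = 0 &
    forall u u', u \in msupp g -> u' \in msupp g -> u = u'].
  suff H : forall s, exists g : {mpoly K[N]}, [/\ g != 0, forall v, g.@[v] = 0 &
    forall u u', u \in msupp g -> u' \in msupp g ->
      forall l : 'I_N, (l < s)%N -> u l = u' l].
    have [g [gN0 g0 gc]] := H N; exists g; split=> // u u' gu gu'; apply/mnmP => l; exact: (gc u u' gu gu' l (ltn_ord l)).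
  elim=> [|s [g [gN0 g0 gc]]]; first by exists f.
  have [sN|Ns] := ltnP s N; last first.
    by exists g; split=> // u u' gu gu' l _; apply: (gc u u') => //; apply: leq_trans (ltn_ord l) Ns.
  pose x := Ordinal sN; have [d dmax gdN0] := mdeg_at_max x gN0.
  exists (slice x d g); split=> // [v|u u'].
    have := @slice_vanish x d g 1 (fun l => (v l)%:P) (oner_neq0 _) dmax (fun _ _ => g0 _).
    by move=> <-; apply: meval_eq => l; rewrite hornerC.
  rewrite !msupp_slice => /andP[gu /eqP ud] /andP[gu' /eqP u'd] l.
  rewrite ltnS leq_eqVlt => /orP[/eqP ls|]; last exact: (gc u u').
  by have -> : l = x; [exact/val_inj | rewrite ud u'd].
case E: (msupp g) => [|u s]; first by move: gN0; rewrite -msupp_eq0 E.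
have us : s = [::].
  case: s E => [|u' s] E //; have := msupp_uniq g; rewrite E /= inE.
  by rewrite (gc u u') ?E ?inE ?eqxx ?orbT.
have := g0 (fun=> 1); rewrite mevalE E us big_seq1 big1 ?mulr1.
  by apply/eqP; rewrite -mcoeff_msupp E mem_head.
by move=> l _; rewrite expr1n.
Qed.

End Evaluation.

(** * Chains of variables, and matrices with dependent columns *)

Section Chains.
Variables (m n : nat).
Local Notation N := (m.+1 * n.+1)%N.

Definition var (i j : nat) : 'I_N := mxvec_index (inord i : 'I_m.+1) (inord j : 'I_n.+1).

Lemma var_inj i j i' j' : (i <= m)%N -> (j <= n)%N -> (i' <= m)%N -> (j' <= n)%N ->
  (var i j == var i' j') = (i == i') && (j == j').
Proof.
move=> im jn im' jn'; apply/eqP/andP => [|[/eqP -> /eqP ->]//].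
move/cast_ord_inj/enum_rank_inj => [] /(congr1 (@nat_of_ord _)) + /(congr1 (@nat_of_ord _)).
by rewrite !inordK // => -> ->.
Qed.

(* Scanning rows upwards from the i-th and greedily matching the columns
   j-1, ..., 0, this decides whether u is divisible by the product of the
   variables (r_0, 0), ..., (r_(j-1), j-1) for some r_0 < ... < r_(j-1) < i. *)
Fixpoint has_chain (i j : nat) (u : 'X_{1..N}) : bool :=
  match j, i with
  | 0, _ => true
  | _.+1, 0 => false
  | j'.+1, i'.+1 => if (0 < u (var i' j'))%N then has_chain i' j' u else has_chain i' j u
  end.

Lemma has_chain0 i u : has_chain i 0 u.
Proof. by case: i. Qed.

Lemma has_chainP i j u : has_chain i j u -> exists r : nat -> nat,
  (forall l, (l < j)%N -> (r l < i)%N /\ (0 < u (var (r l) l))%N) /\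
  (forall l l', (l < l' < j)%N -> (r l < r l')%N).
Proof.
elim: i j => [|i IH] [|j] //=; try by move=> _; exists id; split=> // l l'; lia.
case: ifP => [u_ij|_] /IH[r [ru rr]].
  exists (fun l => if l == j then i else r l); split=> [l|l l'].
    rewrite ltnS; case: eqP => [-> _|/eqP lj lej]; first by [].
    by have [|? ?] := ru l; [lia | split; [lia|]].
  move=> ll'; have -> : (l == j) = false by apply/eqP; lia.
  case: eqP => [l'j|/eqP l'j]; last by apply: rr; lia.
  by case: (ru l); [lia|].
by exists r; split=> // l /ru[? ?]; split; [lia|].
Qed.

Lemma eq_has_chain i j (u u' : 'X_{1..N}) : (i <= m.+1)%N -> (j <= n.+1)%N ->
    (forall r c, (r < i)%N -> (c < j)%N -> u (var r c) = u' (var r c)) ->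
  has_chain i j u = has_chain i j u'.
Proof.
elim: i j => [|i IH] [|j] //= im jn uu'; rewrite uu' //.
by case: ifP => _; apply: IH => // *; try apply: uu'; lia.
Qed.

Variable K : numFieldType.

(** Linear dependence of the columns of the upper left i x j block, with natural number indices so
    that blocks of all sizes share the same ambient matrix. *)
Definition rank_deficient (i j : nat) (v : 'I_N -> K) : Prop :=
  exists y : nat -> K, (exists2 c, (c < j)%N & y c != 0) /\
    forall r, (r < i)%N -> \sum_(c < j) v (var r c) * y c = 0.

(* Adding s / y c0 times column j to column c0 puts column j in the span of the
   preceding columns, for any s != 0; the corner entry is then forced. *)
Lemma rank_deficient_col i j (v : 'I_N -> K) (w : 'I_N -> {poly K}) (y : nat -> K) c0 s :
    (i <= m)%N -> (j <= n)%N -> (c0 < j)%N -> y c0 != 0 -> s != 0 ->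
    (forall r, (r < i)%N -> \sum_(c < j) v (var r c) * y c = 0) ->
    (forall l, w l = (v l)%:P + (\sum_(r < i | var r c0 == l) (v (var r j) / y c0)%:P) * 'X) ->
  rank_deficient i.+1 j.+1
    (fun l => if l == var i j then (\sum_(c < j) v (var i c) * y c) / s else (w l).[s]).
Proof.
move=> im jn c0j yc0 s0 yv wE.
have wn r c : (r <= m)%N -> (c <= n)%N -> (w (var r c)).[s] =
    v (var r c) + (if (c == c0) && (r < i)%N then v (var r j) / y c0 * s else 0).
  move=> rm cn; rewrite wE hornerD hornerC hornerM hornerX horner_sum; congr (_ + _).
  rewrite (eq_bigl (fun r' : 'I_i => (r' == r :> nat) && (c0 == c))); last first.
    by move=> r'; rewrite var_inj //; have := ltn_ord r'; lia.
  case: ifP => [/andP[/eqP -> ri]|H].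
    rewrite (big_pred1 (Ordinal ri)) ?hornerC // => r'.
    by rewrite eqxx andbT.
  by rewrite big1 ?mul0r // => r' /andP[/eqP r'r /eqP c0c]; move: H; rewrite -r'r c0c eqxx ltn_ord.
exists (fun c => if c == j then - s else y c); split.
  by exists c0; [lia | rewrite ltn_eqF].
move=> r ri; rewrite big_ord_recr /= eqxx.
under eq_bigr => c _.
  rewrite var_inj ?(ltn_eqF (ltn_ord c)) ?andbF; [|lia|have := ltn_ord c; lia|lia|lia].
  rewrite wn; [|lia|have := ltn_ord c; lia].
  over.
rewrite var_inj ?eqxx ?andbT; [|lia|lia|lia|lia].
have [rE|rNi] := eqVneq r i.
  rewrite rE (eq_bigr (fun c : 'I_j => v (var i c) * y c)).
    by rewrite mulrN mulfVK // subrr.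
  by move=> c _; rewrite ltnn andbF addr0.
have {rNi}ri' : (r < i)%N by lia.
rewrite (eq_bigr _ (fun c _ => mulrDl _ _ _)) big_split /= yv // add0r (bigD1 (Ordinal c0j)) //= eqxx ri' big1; last first.
  by move=> c /eqP cc0; rewrite (_ : _ == _ = false) ?mul0r //; apply/eqP => cc; apply/cc0/val_inj.
rewrite wn; [|lia|lia].
by rewrite (_ : j == c0 = false) ?addr0 //=; [field | lia].
Qed.

(** If the kernel vector [y] of the smaller block does not annihilate row [i], the corner entry can
    be sent to infinity along deficient matrices. The remaining matrices are limits of such ones. *)
Lemma vanishing_slice i j d (f : {mpoly K[N]}) :
    (i <= m)%N -> (j <= n)%N ->
    (forall u, u \in msupp f -> (u (var i j) <= d)%N) ->
    (forall v, rank_deficient i.+1 j.+1 v -> f.@[v] = 0) ->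
  forall v, rank_deficient i j v -> (slice (var i j) d f).@[v] = 0.
Proof.
move=> im jn dmax f0 v [y [[c0 c0j yc0] yv]].
have gen (v' : 'I_N -> K) : (forall r, (r < i)%N -> \sum_(c < j) v' (var r c) * y c = 0) ->
    \sum_(c < j) v' (var i c) * y c != 0 -> (slice (var i j) d f).@[v'] = 0.
  move=> yv' a0.
  pose w l := (v' l)%:P + (\sum_(r < i | var r c0 == l) (v' (var r j) / y c0)%:P) * 'X.
  rewrite -[RHS](@slice_vanish _ _ (var i j) d f _ w a0 dmax).
    by apply: meval_eq => l; rewrite hornerD hornerC hornerM hornerX mulr0 addr0.
  by move=> s s0; apply: f0; apply: (@rank_deficient_col _ _ v' w y c0).
have [a0|] := eqVneq (\sum_(c < j) v (var i c) * y c) 0; last exact: gen.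
(* Moving the entry (i, c0) by s turns the pairing of row [i] with [y] from 0 into s * [y c0]. *)
pose w l := (v l)%:P + (l == var i c0)%:R *: 'X.
have wE s l : (w l).[s] = v l + (l == var i c0)%:R * s.
  by rewrite hornerD hornerC hornerZ hornerX.
rewrite -[RHS](@meval_vanish0 _ _ (slice (var i j) d f) w).
  by apply: meval_eq => l; rewrite wE mulr0 addr0.
move=> s s0; apply: gen => [r ri|].
  rewrite -[RHS](yv r ri); apply: eq_bigr => c _; rewrite wE var_inj; last 4 first.
  - lia.
  - by have := ltn_ord c; lia.
  - lia.
  - lia.
  by rewrite (ltn_eqF ri) mul0r addr0.
under eq_bigr => c _.
  rewrite wE mulrDl var_inj ?eqxx /=; [|lia|have := ltn_ord c; lia|lia|lia].
  over.
rewrite big_split /= a0 add0r (bigD1 (Ordinal c0j)) //= eqxx big1 ?addr0 ?mul1r ?mulf_neq0 //.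
by move=> c /negPf; rewrite -val_eqE /= => ->; rewrite !mul0r.
Qed.

(** If the corner variable occurs in [f], the top slice has by induction a monomial with a chain in
    the smaller block, and the corner variable extends it. If not, [f] already vanishes when the
    block without its last row is deficient, and induction applies to [f] itself. *)
Lemma vanishing_has_chain i j (f : {mpoly K[N]}) :
    (i <= m.+1)%N -> (j <= n.+1)%N -> f != 0 ->
    (forall v, rank_deficient i j v -> f.@[v] = 0) ->
  exists2 u, u \in msupp f & has_chain i j u.
Proof.
elim: i j f => [|i IH] [|j] f im jn fN0 f0; try by
  case E: (msupp f) => [|u s]; [move: fN0; rewrite -msupp_eq0 E | exists u; rewrite ?mem_head ?has_chain0].
  (* With no rows and at least one column every point is deficient, so [f] vanishes identically. *)
  case/eqP: fN0; apply: meval_eq0 => v; apply: f0.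
  by exists (fun=> 1); split=> //; exists 0%N; rewrite ?oner_neq0.
have [d dmax gN0] := mdeg_at_max (var i j) fN0.
have g0 := vanishing_slice im jn dmax f0.
have [d0|d_gt0] := posnP d; last first.
  have [u] := IH j _ (ltnW im) (ltnW jn) gN0 g0.
  rewrite msupp_slice => /andP[fu /eqP ud] uc; exists u => //=.
  by rewrite ud d_gt0.
have fE : slice (var i j) d f = f.
  apply/mpolyP => u; rewrite mcoeff_slice; case: eqP => // ud.
  apply/esym/memN_msupp_eq0; apply/negP => /dmax; move: ud; lia.
have [|u fu uc] := IH j.+1 f (ltnW im) jn fN0; last first.
  by exists u => //=; have := dmax u fu; rewrite d0 leqNgt => /negPf ->.
move=> v [y [[c cj yc] yv]].
(* If [y j] is 0, then [y] is a kernel vector of the i x j block, where the slice, here equal to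
   [f], vanishes. *)
have [yj|yj] := eqVneq (y j) 0.
  rewrite -fE; apply: g0; exists y; split.
    exists c => //; move: cj; rewrite ltnS leq_eqVlt => /orP[/eqP cE|//].
    by rewrite cE yj eqxx in yc.
  by move=> r ri; rewrite -[RHS](yv r ri) big_ord_recr /= yj mulr0 addr0.
(* The corner entry for which [y] annihilates row [i] too; changing it does not affect the value of
   [f]. *)
pose x := - (\sum_(c < j) v (var i c) * y c) / y j.
have rd : rank_deficient i.+1 j.+1 (fun l => if l == var i j then x else v l).
  exists y; split; first by exists c.
  move=> r ri; rewrite big_ord_recr /= var_inj ?eqxx ?andbT; [|lia|lia|lia|lia].
  have [rE|rNi] := eqVneq r i.
    rewrite /x mulfVK // rE -[LHS]/(_ - _); apply/eqP; rewrite subr_eq0; apply/eqP.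
    apply: eq_bigr => c' _; rewrite var_inj; last 4 first.
    - lia.
    - by have := ltn_ord c'; lia.
    - lia.
    - lia.
    by rewrite (ltn_eqF (ltn_ord c')) andbF.
  have {}ri : (r < i)%N by lia.
  rewrite -[RHS](yv r ri) big_ord_recr; congr (_ + _); apply: eq_bigr => c' _.
  rewrite var_inj; last 4 first.
  - lia.
  - by have := ltn_ord c'; lia.
  - lia.
  - lia.
  by rewrite (ltn_eqF ri).
rewrite -[RHS](f0 _ rd) !mevalE !big_seq; apply: eq_bigr => u /dmax; rewrite d0 leqn0 => /eqP ux.
by congr (_ * _); apply: eq_bigr => l _; case: eqP => // ->; rewrite ux !expr0.
Qed.

End Chains.

(** * The ideal of maximal minors and the basis of standard monomials *)

Lemma ideal_gen_mull (K : fieldType) N (G : {mpoly K[N]} -> Prop) p q :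
  ideal_gen G p -> ideal_gen G (q * p).
Proof.
move=> [s sG ->]; exists [seq (q * x.1, x.2) | x <- s].
  by move=> _ /mapP[x xs ->]; exact: (sG x).
by rewrite big_map mulr_sumr; apply: eq_bigr => x _; rewrite mulrA.
Qed.

Lemma ideal_gen_in (K : fieldType) N (G : {mpoly K[N]} -> Prop) p : G p -> ideal_gen G p.
Proof.
move=> Gp; exists [:: (1, p)]; first by move=> x; rewrite inE => /eqP ->.
by rewrite big_seq1 mul1r.
Qed.

Lemma homo_ltn_ord_inj s t (f : 'I_s -> 'I_t) : {homo f : i j / (i < j)%N} -> injective f.
Proof.
move=> fh i j fij; apply/val_inj/eqP => /=; rewrite eqn_leq.
by apply/andP; split; rewrite leqNgt; apply/negP => /fh; rewrite fij ltnn.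
Qed.

Section Minors.
Variables (K : numFieldType) (m n : nat).
Local Notation N := (m.+1 * n.+1)%N.
Local Notation minor := (is_minor n.+1 (generic_matrix K m.+1 n.+1)).

Lemma mxvec_indexE (i : 'I_m.+1) (j : 'I_n.+1) : mxvec_index i j = var m n i j.
Proof. by rewrite /var !inord_val. Qed.

Lemma mxvec_index_eq (i i' : 'I_m.+1) (j j' : 'I_n.+1) :
  (mxvec_index i j == mxvec_index i' j') = (i == i') && (j == j').
Proof. by rewrite !mxvec_indexE var_inj ?leq_ord. Qed.

(** The column selection [g] is an injective self-map of a finite set, hence a bijection, so [y]
    reindexed by [g] is a kernel vector of the selected square submatrix. *)
Lemma minor_vanish p v : minor p -> rank_deficient m.+1 n.+1 v -> p.@[v] = 0.
Proof.
move=> [f [g [_ gh ->]]] [y [[c cn yc] yv]].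
have g_inj := homo_ltn_ord_inj gh.
rewrite -det_map_mx -det_tr; apply/eqP/det0P.
exists (\row_i y (g i)).
  apply: contra_neq yc => /rowP y0.
  have [h _ gK] := injF_bij g_inj.
  by have := y0 (h (Ordinal cn)); rewrite !mxE gK.
apply/rowP => r; rewrite !mxE -[RHS](yv (f r)) // [RHS](reindex g); last exact/onW_bij/injF_bij.
by apply: eq_bigr => j _; rewrite !mxE /= mevalXU mxvec_indexE mulrC.
Qed.

Lemma ideal_vanish p v :
  ideal_gen minor p -> rank_deficient m.+1 n.+1 v -> p.@[v] = 0.
Proof.
move=> [s sG ->] vd; rewrite raddf_sum big_seq big1 // => x xs.
by rewrite /= mevalM (minor_vanish (sG _ xs) vd) mulr0.
Qed.

(** A numerical replacement for a monomial order: each variable contributes its row as a digit in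
    base m + 1, placed at the position of its column. It singles out the diagonal term of each
    maximal minor as the heaviest. *)
Definition weight (u : 'X_{1..N}) : nat :=
  \sum_(r < m.+1) \sum_(c < n.+1) u (mxvec_index r c) * (r * m.+1 ^ c).

Lemma weightD u u' : weight (u + u')%MM = (weight u + weight u')%N.
Proof.
rewrite /weight -big_split; apply: eq_bigr => r _; rewrite -big_split; apply: eq_bigr => c _.
by rewrite mnmDE mulnDl.
Qed.

Lemma weight_sum I (r : seq I) (F : I -> 'X_{1..N}) :
  weight (\sum_(i <- r) F i)%MM = (\sum_(i <- r) weight (F i))%N.
Proof.
apply: (big_morph weight weightD); rewrite /weight big1 // => i _.
by rewrite big1 // => c _; rewrite mnmE mul0n.
Qed.

Lemma weight1 (r : 'I_m.+1) (c : 'I_n.+1) : weight U_(mxvec_index r c)%MM = (r * m.+1 ^ c)%N.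
Proof.
have vE r' c' : U_(mxvec_index r c)%MM (mxvec_index r' c') = (r' == r) && (c' == c) :> nat.
  by rewrite mnm1E mxvec_index_eq eq_sym [c == _]eq_sym.
rewrite /weight (bigD1 r) //= (bigD1 c) //= vE !eqxx mul1n !big1 ?addn0 //.
  by move=> r' /negPf rr; rewrite big1 // => c' _; rewrite vE rr.
by move=> c' /negPf cc; rewrite vE cc andbF.
Qed.

(* At the largest c with s c != c the value of f drops, which outweighs
   whatever happens in the lower digits in base m + 1. *)
Lemma weight_perm (f : 'I_n.+1 -> 'I_m.+1) (s : {perm 'I_n.+1}) :
  {homo f : i j / (i < j)%N} -> s != 1%g ->
  (\sum_c f (s c) * m.+1 ^ c < \sum_c f c * m.+1 ^ c)%N.
Proof.
move=> fh s1.
have [c0 sc0] : exists c, s c != c.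
  apply/existsP; apply: contraR s1; rewrite negb_exists => /forallP sc.
  by apply/eqP/permP => c; rewrite perm1; apply/eqP; rewrite -[_ == _]negbK.
case: (@arg_maxnP _ c0 (fun c => s c != c) (@nat_of_ord _) sc0) => l sl lmax.
have sE (c : 'I_n.+1) : (l < c)%N -> s c = c.
  by move=> lc; apply/eqP; apply: contraTT lc => /lmax; rewrite -leqNgt.
have sll : (s l < l)%N.
  rewrite ltnNge leq_eqVlt negb_or; apply/andP; split.
    by apply: contraNneq sl => ll; apply/eqP/val_inj.
  by apply/negP => /sE /perm_inj ss; rewrite ss eqxx in sl.
have low t : (\sum_(c < n.+1 | c < t) f (s c) * m.+1 ^ c < m.+1 ^ t)%N.
  elim: t => [|t IH]; first by rewrite big_pred0.
  have [tn|nt] := ltnP t n.+1; last first.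
    rewrite (eq_bigl (fun c : 'I_n.+1 => (c < t)%N)).
      by apply: leq_trans IH _; rewrite leq_pexp2l.
    by move=> c; have := ltn_ord c; lia.
  rewrite (bigD1 (Ordinal tn)) //= (eq_bigl (fun c : 'I_n.+1 => (c < t)%N)); last first.
    by move=> c; rewrite -val_eqE /=; lia.
  have := ltn_ord (f (s (Ordinal tn))); move: IH; rewrite expnS.
  move: (nat_of_ord (f _)) (\sum_(_ | _) _)%N (m.+1 ^ t)%N => a b d; nia.
have split3 (F : 'I_n.+1 -> nat) : (\sum_c F c = \sum_(c < n.+1 | c < l) F c + F l
    + \sum_(c < n.+1 | l < c) F c)%N.
  rewrite (bigID (fun c : 'I_n.+1 => (l < c)%N)) /= addnC; congr (_ + _)%N.
  rewrite (bigD1 l) ?ltnn //= addnC; congr (_ + _)%N.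
  by apply: eq_bigl => c; rewrite -val_eqE /=; lia.
rewrite !split3 (eq_bigr (fun c : 'I_n.+1 => f c * m.+1 ^ c)%N (P := fun c : 'I_n.+1 => (l < c)%N)).
  rewrite ltn_add2r; have := low l; have := fh _ _ sll.
  move: (nat_of_ord (f (s l))) (nat_of_ord (f l)) (\sum_(c < _ | c < l) f (s _) * _)%N.
  move=> a b d ab; move: (m.+1 ^ l)%N (\sum_(_ | _) _)%N => e g; nia.
by move=> c /sE ->.
Qed.

(** The chain is the heaviest term of the maximal minor on its rows, so a monomial multiple of that
    minor rewrites [u] by lighter monomials of the same degree. *)
Lemma chain_reduce (u : 'X_{1..N}) : has_chain m.+1 n.+1 u ->
  exists s : seq (K * 'X_{1..N}),
    [/\ ideal_gen minor ('X_[u] - \sum_(x <- s) x.1 *: 'X_[x.2])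
      , forall x, x \in s -> mdeg x.2 = mdeg u
      & forall x, x \in s -> (weight x.2 < weight u)%N].
Proof.
move=> /has_chainP[r [ru rr]].
pose f (c : 'I_n.+1) : 'I_m.+1 := inord (r c).
have fE c : f c = r c :> nat by rewrite inordK //; have [] := ru c (ltn_ord c).
have fh : {homo f : i j / (i < j)%N}.
  by move=> i j ij; rewrite !fE; apply: rr; rewrite ij ltn_ord.
pose U (s : {perm 'I_n.+1}) := (\sum_c U_(mxvec_index (f (s c)) c))%MM.
have detE : \det (mxsub f id (generic_matrix K m.+1 n.+1))
    = \sum_(s : {perm 'I_n.+1}) (-1) ^+ s *: 'X_[U s].
  rewrite -det_tr; apply: eq_bigr => s _.
  rewrite -mul_mpolyC rmorphXn rmorphN rmorph1; congr (_ * _).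
  by rewrite (big_morph _ (@mpolyXD N K) (@mpolyX0 N K)); apply: eq_bigr => c _; rewrite !mxE.
have Uu : (U 1%g <= u)%MM.
  apply/mnm_lepP => l; rewrite mnm_sumE.
  have [l0|] := posnP (\sum_c U_(mxvec_index (f ((1%g : {perm 'I_n.+1}) c)) c)%MM l)%N; first by rewrite l0.
  rewrite lt0n sum_nat_eq0 negb_forall => /existsP[c /=].
  rewrite mnm1E perm1; case: (mxvec_index (f c) c =P l) => // <- _.
  rewrite (bigD1 c) //= big1 ?addn0.
    rewrite mnm1E perm1 eqxx mxvec_indexE fE.
    by have [] := ru c (ltn_ord c).
  by move=> c' cc'; rewrite mnm1E perm1 mxvec_index_eq (negPf cc') andbF.
have degU s : mdeg (U s) = n.+1.
  rewrite mdeg_sum (eq_bigr (fun=> 1%N)) ?sum1_card ?card_ord // => c _.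
  by rewrite mdeg1.
have wU s : weight (U s) = (\sum_c f (s c) * m.+1 ^ c)%N.
  by rewrite weight_sum; apply: eq_bigr => c _; rewrite weight1.
have uE : u = (U 1%g + (u - U 1%g))%MM by rewrite addmC submK.
(* The non-identity terms of the determinant with opposite sign, times the quotient of [u] by the
   chain [U 1]. *)
exists [seq (- (-1) ^+ s, (U s + (u - U 1%g))%MM) | s : {perm 'I_n.+1} <- enum (predC1 1%g)]; split.
- have /(@ideal_gen_mull _ _ _ _ 'X_[u - U 1%g]) :
    ideal_gen minor (\det (mxsub f id (generic_matrix K m.+1 n.+1))).
    by apply: ideal_gen_in; exists f, id; split.
  congr ideal_gen; rewrite detE mulr_sumr (bigD1 1%g) //= odd_perm1 expr0 scale1r.
  rewrite -mpolyXD addmC -uE; congr (_ + _).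
  rewrite big_map big_enum /= -sumrN; apply: eq_bigr => s _.
  by rewrite -scalerAr -mpolyXD scaleNr opprK addmC.
- by move=> _ /mapP[s _ ->] /=; rewrite [in RHS]uE !mdegD !degU.
- move=> _ /mapP[s + ->] /=; rewrite mem_enum inE => s1.
  rewrite [in X in (_ < X)%N]uE !weightD ltn_add2r !wU.
  by under [X in (_ < X)%N]eq_bigr do rewrite perm1; exact: weight_perm.
Qed.

Definition standard d (u : 'X_{1..N}) := (mdeg u == d) && ~~ has_chain m.+1 n.+1 u.

(** A combination of standard monomials lying in the ideal vanishes on all deficient matrices, so if
    nonzero it would contain a monomial with a chain. Spanning is by induction on the weight through
    [chain_reduce]. The bound [b] makes the monomials a finite type. *)
Lemma quotient_dim_standard b d : (d < b)%N ->
  quotient_dim minor d #|[set u : 'X_{1..N < b} | standard d u]|.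
Proof.
move=> db; set A := [set _ | _].
pose e (i : 'I_#|A|) : {mpoly K[N]} := 'X_[bmnm (enum_val i : 'X_{1..N < b})].
have eA (i : 'I_#|A|) : standard d (bmnm (enum_val i)) by have := enum_valP i; rewrite inE.
exists e; split=> [i|a Ia|v vd].
- by rewrite dhomogX; case/andP: (eA i).
- have coefE j : (\sum_i a i *: e i)@_(bmnm (enum_val j)) = a j.
    rewrite raddf_sum (bigD1 j) //= mcoeffZ mcoeffX eqxx mulr1 big1 ?addr0 // => i ij.
    rewrite mcoeffZ mcoeffX (_ : _ == _ = false) ?mulr0 //.
    by apply: contra_neqF ij => /eqP/val_inj/enum_val_inj.
  have [f0 i|fN0] := eqVneq (\sum_i a i *: e i) 0; first by rewrite -coefE f0 mcoeff0.
  have [u fu uc] := vanishing_has_chain (leqnn _) (leqnn _) fN0 (fun _ => ideal_vanish Ia).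
  suff : standard d u by rewrite /standard uc andbF.
  have := msupp_sum_le fu => /flattenP[_ /mapP[i _ ->]] /msuppZ_le.
  by rewrite msuppX inE => /eqP ->.
pose spanned (v : {mpoly K[N]}) := exists a : 'I_#|A| -> K,
  ideal_gen minor (v - \sum_i a i *: e i).
have span_lin s (F : 'X_{1..N} -> {mpoly K[N]}) (w : K * 'X_{1..N} -> K) :
    (forall x, x \in s -> spanned (F x.2)) -> spanned (\sum_(x <- s) w x *: F x.2).
  elim: s => [|x s IH] sF.
    exists (fun=> 0); rewrite big_nil big1 ?subr0 => [|i _]; last by rewrite scale0r.
    exact: ideal_gen0.
  have [|a1 a1P] := IH; first by move=> z zs; apply: sF; rewrite inE zs orbT.
  have [a2 a2P] := sF x (mem_head _ _).
  exists (fun i => w x * a2 i + a1 i).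
  have := ideal_genP (w x) a2P a1P; congr ideal_gen.
  rewrite big_cons scalerBr scaler_sumr.
  under [X in _ = _ - X]eq_bigr do rewrite scalerDl -scalerA.
  by rewrite big_split /= opprD addrACA.
have spanX u : mdeg u = d -> spanned 'X_[u].
  have [w] := ubnP (weight u); elim: w u => // w IH u; rewrite ltnS => uw ud.
  have [|uc] := boolP (has_chain m.+1 n.+1 u).
    move=> /chain_reduce[s [Is sd sw]].
    have [|a aP] := span_lin s (fun u => 'X_[u]) (fun x => x.1).
      by move=> x xs; apply: IH; [exact: leq_trans (sw _ xs) uw | rewrite sd].
    exists a; have := ideal_genP 1 Is aP; congr ideal_gen.
    by rewrite scale1r addrA subrK.
  have ult : (mdeg u < b)%N by rewrite ud.
  have uA : BMultinom ult \in A by rewrite inE /standard /= ud eqxx.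
  exists (fun i => (i == enum_rank_in uA (BMultinom ult))%:R).
  rewrite (bigD1 (enum_rank_in uA (BMultinom ult))) //= eqxx scale1r big1 ?addr0.
    by rewrite /e enum_rankK_in // subrr; exact: ideal_gen0.
  by move=> i /negPf ->; rewrite scale0r.
rewrite [v]mpolyE.
rewrite -(big_map (fun u => (v@_u, u)) predT (fun x => x.1 *: 'X_[x.2])).
apply: (span_lin _ (fun u => 'X_[u])) => _ /mapP[u uv ->] /=.
by apply: spanX; exact: (dhomog_mf vd).
Qed.

Lemma hilbert_function_minors b d : (d < b)%N ->
  hilbert_function minor d = #|[set u : 'X_{1..N < b} | standard d u]|.
Proof. by move=> db; exact/hilbert_functionP/quotient_dim_standard. Qed.

End Minors.

(** * Congruence of truncated power series *)

Section EqPolyMod.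
Variable b : nat.
Implicit Types p q r : {poly int}.

(** Congruence modulo ['X^b], which lets polynomials stand for truncated power series. *)
Definition eqpm p q := forall d, (d < b)%N -> p`_d = q`_d.

Lemma eqpm_trans p q r : eqpm p q -> eqpm q r -> eqpm p r.
Proof. by move=> pq qr d db; rewrite pq // qr. Qed.

Lemma eqpmD p q p' q' : eqpm p q -> eqpm p' q' -> eqpm (p + p') (q + q').
Proof. by move=> pq pq' d db; rewrite !coefD pq ?pq'. Qed.

Lemma eqpmM r p q : eqpm p q -> eqpm (r * p) (r * q).
Proof.
move=> pq d db; rewrite !coefM; apply: eq_bigr => i _; rewrite pq //.
by apply: leq_ltn_trans db; rewrite leq_subr.
Qed.

(** The constant term of [1 - 'X] is 1, so the coefficients are recovered one by one from degree 0
    upwards. *)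
Lemma eqpm_cancel p q : eqpm ((1 - 'X) * p) ((1 - 'X) * q) -> eqpm p q.
Proof.
move=> pq; elim=> [|d IH] db; have := pq _ db.
  by rewrite !mulrBl !mul1r !coefB !coefXM /= !subr0.
rewrite !mulrBl !mul1r !coefB !coefXM /= IH ?(ltnW db) //.
exact: addIr.
Qed.

Lemma eqpm_cancelX p q s : eqpm ((1 - 'X) ^+ s * p) ((1 - 'X) ^+ s * q) -> eqpm p q.
Proof.
elim: s => [|s IH]; first by rewrite expr0 !mul1r.
by rewrite exprS -!mulrA => /eqpm_cancel /IH.
Qed.

End EqPolyMod.

(** * Generating functions of sets of monomials by degree *)

Section Counting.
Variables (N b : nat).
Implicit Types (phi psi : pred 'X_{1..N}) (u : 'X_{1..N}).

Definition mnm_count phi d : nat :=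
  #|[set u : 'X_{1..N < b} | (mdeg u == d) && phi u]|.

Definition mnm_series phi : {poly int} := \poly_(d < b) (mnm_count phi d)%:Z.

Lemma eq_mnm_series phi psi d :
  phi =1 psi -> (mnm_series phi)`_d = (mnm_series psi)`_d.
Proof.
move=> pp; rewrite !coef_poly; congr (if _ then Posz _ else _).
by apply: eq_card => u; rewrite !inE pp.
Qed.

Lemma mnm_series_split phi psi :
  mnm_series phi = mnm_series (predI phi psi) + mnm_series (predI phi (predC psi)).
Proof.
apply/polyP => d; rewrite coefD !coef_poly; case: ifP => // _.
rewrite -PoszD; congr Posz; rewrite -[LHS](cardsID [set u : 'X_{1..N < b} | psi u]).
by congr (_ + _)%N; apply: eq_card => u; rewrite !inE /=; case: (psi u); rewrite ?andbF ?andbT.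
Qed.

(** Multiplication by the variable [l] maps the monomials of degree d in [phi] bijectively onto
    those of degree d + 1 in [phi] that it divides. *)
Lemma mnm_series_shift phi (l : 'I_N) : (forall u, phi (U_(l) + u)%MM = phi u) ->
  eqpm b (mnm_series [pred u | phi u & (0 < u l)%N]) ('X * mnm_series phi).
Proof.
move=> phil [|d] db; rewrite coefXM !coef_poly db /=.
  rewrite /mnm_count (_ : [set _ | _] = set0) ?cards0 //.
  apply/setP => u; rewrite !inE mdeg_eq0; apply/negP => /andP[/eqP ->].
  by rewrite mnm0E ltnn andbF.
rewrite (ltnW db); congr Posz; rewrite /mnm_count.
have Ult (u : 'X_{1..N < b}) : mdeg u = d -> (mdeg (U_(l) + u)%MM < b)%N.
  by move=> ud; rewrite mdegD mdeg1 ud add1n.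
(* The default [u] of [insubd] is never taken in degree d, as d + 1 < b. *)
pose F (u : 'X_{1..N < b}) : 'X_{1..N < b} := insubd u (U_(l) + u)%MM.
have FE (u : 'X_{1..N < b}) : mdeg u = d -> bmnm (F u) = (U_(l) + u)%MM.
  by move=> /Ult; rewrite /F -[bmnm _]/(val _) val_insubd => ->.
have Finj : {in [set u : 'X_{1..N < b} | (mdeg u == d) && phi u] &, injective F}.
  move=> u u'; rewrite !inE => /andP[/eqP ud _] /andP[/eqP u'd _] /(congr1 (@bmnm _ _)).
  rewrite !FE // => /(congr1 (fun z => z - U_(l))%MM).
  by rewrite ![(U_(l) + _)%MM]addmC !addmK => /val_inj.
rewrite -(card_in_imset Finj); apply: eq_card => u; rewrite !inE /=.
apply/idP/imsetP => [/and3P[/eqP ud uphi ul]|[w + ->]]; last first.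
  rewrite inE => /andP[/eqP wd wphi].
  by rewrite FE // phil wphi mdegD mdeg1 wd eqxx mnmDE mnm1E eqxx.
have Uu : (U_(l) <= bmnm u)%MM.
  by apply/mnm_lepP => i; rewrite mnm1E; case: eqP => // <-.
have uE : bmnm u = (U_(l) + (u - U_(l)))%MM by rewrite addmC submK.
have wd : mdeg (u - U_(l))%MM = d.
  by apply/eqP; rewrite -eqSS -ud [in X in _ == X]uE mdegD mdeg1.
have wb : (mdeg (u - U_(l))%MM < b)%N by rewrite wd (ltnW db).
exists (BMultinom wb); first by rewrite inE /= wd eqxx -phil -uE.
by apply/val_inj; rewrite /= FE.
Qed.

Lemma mnm_series_var0 phi (l : 'I_N) : (forall u, phi (U_(l) + u)%MM = phi u) ->
  eqpm b (mnm_series [pred u | phi u & u l == 0%N]) ((1 - 'X) * mnm_series phi).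
Proof.
move=> phil d db; have := mnm_series_shift phil db.
rewrite mulrBl mul1r coefB => <-.
rewrite (mnm_series_split phi [pred u : 'X_{1..N} | (0 < u l)%N]) coefD addrAC subrr add0r.
by apply: eq_mnm_series => u /=; rewrite -leqNgt leqn0.
Qed.

(** Excluding the variables one at a time contributes a factor [1 - 'X] each, and in the end only
    the monomial 1 is left. *)
Lemma mnm_series_all : eqpm b ((1 - 'X) ^+ N * mnm_series predT) 1.
Proof.
case: (posnP b) => [-> //|b0].
pose Z s : pred 'X_{1..N} := fun u => [forall l : 'I_N, (l < s)%N ==> (u l == 0%N)].
have ZS s : (s <= N)%N -> eqpm b (mnm_series (Z s)) ((1 - 'X) ^+ s * mnm_series predT).
  elim: s => [|s IH] sN.
    rewrite expr0 mul1r => d _; apply: eq_mnm_series => u.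
    by apply/forallP => l.
  pose l := Ordinal sN.
  have Zl u : Z s (U_(l) + u)%MM = Z s u.
    apply: eq_forallb => i; rewrite mnmDE mnm1E.
    by case: (l =P i) => // <-; rewrite /= ltnn.
  rewrite exprS -mulrA; apply: eqpm_trans (eqpmM _ (IH (ltnW sN))).
  apply: eqpm_trans (mnm_series_var0 Zl) => d db; apply: eq_mnm_series => u /=.
  apply/forallP/andP => [Zu|[/forallP Zu ul] i].
    split; last exact: (implyP (Zu l)).
    by apply/forallP => i; apply/implyP => si; apply: (implyP (Zu i)); apply: ltnW.
  apply/implyP; rewrite ltnS leq_eqVlt => /orP[/eqP il|]; last exact/implyP.
  by rewrite (_ : i = l) //; apply/val_inj.
move=> d db; rewrite -(ZS N) // coef_poly db coef1.
have Z0 u : Z N u = (u == 0%MM).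
  apply/forallP/eqP => [Zu|-> l]; last by rewrite mnm0E eqxx implybT.
  by apply/mnmP => l; rewrite mnm0E; apply/eqP/(implyP (Zu l)).
have b0' : (mdeg (0%MM : 'X_{1..N}) < b)%N by rewrite mdeg0.
rewrite /mnm_count; case: d db => [|d] db.
  rewrite (_ : [set _ | _] = [set BMultinom b0']) ?cards1 //=.
  by apply/setP => u; rewrite !inE Z0 -mdeg_eq0 andbb mdeg_eq0 -val_eqE.
rewrite (_ : [set _ | _] = set0) ?cards0 //.
apply/setP => u; rewrite !inE Z0; apply/negP => /andP[/[swap] /eqP ->].
by rewrite mdeg0.
Qed.

End Counting.

(** * The recursion for monomials without a chain and its closed form *)

Fixpoint chain_poly (i j : nat) : {poly int} :=
  match j, i with
  | 0, _ => 0
  | _.+1, 0 => 1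
  | j'.+1, i'.+1 => (1 - 'X) * chain_poly i' j + 'X * chain_poly i' j'
  end.

Lemma chain_poly0 i : chain_poly i 0 = 0.
Proof. by case: i. Qed.

Lemma chain_polyS i j : chain_poly i.+1 j.+1 =
  (1 - 'X) * chain_poly i j.+1 + 'X * chain_poly i j.
Proof. by []. Qed.

(** This reflects that a chain needs as many rows as columns: with fewer rows all monomials are
    counted. *)
Lemma chain_poly1 i j : (i < j)%N -> chain_poly i j = 1.
Proof.
elim: i j => [|i IH] [|j] //= ij; rewrite !IH //; first by ring.
exact: ltnW.
Qed.

(** The expansion of (1 - X)^(-c) truncated after degree k. The predecessor on natural numbers gives
    the correct coefficient 1 at c = j = 0. *)
Definition q_trunc (k c : nat) : {poly int} :=
  \sum_(j < k.+1) ('C((c + j).-1, j)%:Z)%:P * 'X^j.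

(** Truncation of (1 - X)^(-c-1) = (1 - X)^(-c) + X (1 - X)^(-c-1), which is Pascal's rule on
    coefficients. *)
Lemma q_truncS k c : q_trunc k.+1 c.+1 = q_trunc k.+1 c + 'X * q_trunc k c.+1.
Proof.
rewrite /q_trunc !(big_ord_recl k.+1) /= !bin0 -addrA; congr (_ + _).
rewrite mulr_sumr -big_split; apply: eq_bigr => j _ /=.
rewrite /bump /= !add1n exprS !addnS /= binS PoszD polyCD; ring.
Qed.

Lemma chain_polyE k c : chain_poly (k + c) k.+1 = (1 - 'X) ^+ c * q_trunc k c.
Proof.
have q0 c' : q_trunc 0 c' = 1.
  by rewrite /q_trunc big_ord1 /= bin0 mulr1.
have qk0 k' : q_trunc k' 0 = 1.
  rewrite /q_trunc big_ord_recl /= bin0 mulr1 big1 ?addr0 // => j _.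
  by rewrite /bump add1n add0n /= bin_small // polyC0 mul0r.
(* The recursion at (k + 1, c + 1) calls the cases (k + 1, c) and (k, c + 1), hence two nested
   inductions. *)
elim: c k => [|c IHc] k; first by rewrite addn0 chain_poly1 // expr0 mul1r qk0.
elim: k => [|k IHk].
  rewrite add0n [LHS]/= chain_poly0 mulr0 addr0 -[X in chain_poly X]add0n IHc !q0 !mulr1.
  by rewrite exprS.
rewrite addnS [LHS](chain_polyS (k.+1 + c) k.+1) IHc addSnnS IHk q_truncS exprS.
by ring.
Qed.

Lemma q_polyE k c : q_poly k c = q_trunc k c.+1.
Proof. by rewrite /q_poly /q_trunc; apply: eq_bigr => j _; rewrite addSn. Qed.

(** Monomials are split by whether the corner variable divides them. Either way the remaining
    condition concerns earlier rows only and is independent of that variable, so the two parts yield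
    the factors [1 - 'X] and ['X]. *)
Lemma chain_series m n b i j : (i <= m.+1)%N -> (j <= n.+1)%N ->
  eqpm b ((1 - 'X) ^+ (m.+1 * n.+1) * mnm_series b (predC (@has_chain m n i j)))
    (chain_poly i j).
Proof.
have count0 : eqpm b ((1 - 'X) ^+ (m.+1 * n.+1) * @mnm_series (m.+1 * n.+1) b pred0) 0.
  move=> d db; rewrite (_ : mnm_series _ _ = 0) ?mulr0 //.
  apply/polyP => e; rewrite coef_poly coef0 /mnm_count; case: ifP => // _.
  by rewrite (_ : [set _ | _] = set0) ?cards0 //; apply/setP => u; rewrite !inE andbF.
(* Without columns every monomial has the empty chain and none is counted; with columns but no rows
   all are counted. *)
elim: i j => [|i IH] [|j] im jn /=.
- by apply: eqpm_trans count0; apply: eqpmM => d db; apply: eq_mnm_series.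
- apply: eqpm_trans (@mnm_series_all (m.+1 * n.+1) b); apply: eqpmM => d db.
  exact: eq_mnm_series.
- by apply: eqpm_trans count0; apply: eqpmM => d db; apply: eq_mnm_series.
set l := var m n i j.
have indep i' j' u : (i' <= i)%N -> (j' <= j.+1)%N ->
    predC (has_chain i' j') (U_(l) + u)%MM = predC (@has_chain m n i' j') u.
  move=> ii jj /=; congr (~~ _); apply: eq_has_chain; [lia|lia|].
  move=> r c ri cj; rewrite mnmDE mnm1E var_inj; [|lia|lia|lia|lia].
  by rewrite (_ : (i == r) = false) //; lia.
rewrite (mnm_series_split b _ [pred u : 'X_{1..m.+1 * n.+1} | u l == 0%N]) mulrDr.
apply: eqpmD.
  apply: eqpm_trans (eqpmM _ (IH j.+1 (ltnW im) jn)).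
  rewrite mulrCA; apply: eqpmM.
  apply: eqpm_trans (mnm_series_var0 (b := b) (l := l) (fun u => indep i j.+1 u (leqnn _) (leqnn _))).
  move=> d db; apply: eq_mnm_series => u /=.
  by case: (eqVneq (u l) 0%N) => [->|]; rewrite ?andbF.
apply: eqpm_trans (eqpmM _ (IH j (ltnW im) (ltnW jn))).
rewrite mulrCA; apply: eqpmM.
apply: eqpm_trans (mnm_series_shift (b := b) (l := l) (fun u => indep i j u (leqnn _) (leqnSn _))).
move=> d db; apply: eq_mnm_series => u /=.
by rewrite -lt0n; case: (ltnP 0 (u l)) => [ul|]; rewrite ?andbF ?andbT // ul.
Qed.

(** * The Hilbert series of the ideal of maximal minors *)

Theorem maximal_minors_hilbert_series (K : numFieldType) (c k : nat) :
  is_series_of (determinantal_hilbert_series K k.+1 (k + c).+1 k.+1)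
    (q_poly k c) ((1 - 'X) ^+ (k * (k + 2 + c))).
Proof.
split=> [|d].
  by rewrite -horner_coef0 horner_exp hornerD hornerN hornerX hornerC subr0 expr1n unitr1.
pose F := mnm_series d.+1 (predC (@has_chain (k + c) k (k + c).+1 k.+1)).
have FE : eqpm d.+1 ((1 - 'X) ^+ (k * (k + 2 + c)) * F) (q_poly k c).
  (* Since (k + 1 + c)(k + 1) = k (k + 2 + c) + (c + 1), the surplus power of [1 - 'X] is exactly
     the one that [chain_polyE] provides at c + 1. *)
  apply: (@eqpm_cancelX _ _ _ c.+1); rewrite mulrA -exprD.
  rewrite q_polyE -chain_polyE addnS (_ : (_ + _)%N = ((k + c).+1 * k.+1)%N); last by ring.
  by rewrite addnS; apply: chain_series.
rewrite -FE // mulrC coefM; apply: eq_bigr => i _; congr (_ * _).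
rewrite /determinantal_hilbert_series /hilbert_series (hilbert_function_minors _ _ _ (ltn_ord i)).
by rewrite coef_poly ltn_ord.
Qed.

Theorem mainTheorem10 (R : realType) (c k : nat) (hk : (1 <= k)%N) :
  is_series_of
    (determinantal_hilbert_series R[i]%C (k + 1) (k + 1 + c) (k + 1))
    (q_poly k c)
    ((1 - 'X) ^+ (k * (k + 2 + c))).
Proof.
rewrite !addn1 addSn; exact: maximal_minors_hilbert_series.
Qed.
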